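(* Let $p$ be an odd prime, let $G$ be a finite $p$-group, and let $A$ be a finite $p$-group acting on $G$ by automorphisms. If $G$ is $d$-maximal for $A$-subgroups, then $G$ has nilpotency class $\leq 2$.
   Context: All groups are finite. For a finite $p$-group $G$, $d(G)$ denotes the minimal number of generators of $G$, so $d(G)=\dim_{\mathbb{F}_p} G/\Phi(G)$, where $\Phi(G)$ is the Frattini subgroup. If a group $A$ acts on $G$ (by automorphisms), an $A$-subgroup of $G$ is a subgroup of $G$ which is $A$-invariant. The group $G$ is called $d$-maximal for $A$-subgroups if $d(H)<d(G)$ for every proper $A$-subgroup $H$ of $G$. *)

(* Defs.v *)
From mathcomp Require Import all_boot all_fingroup all_solvable.
Set Implicit Arguments.
Unset Strict Implicit.
Unset Printing Implicit Defensive.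

Local Open Scope group_scope.

(* 'm(H) is the minimal size of a generating set of H, i.e. d(H); the
   A-subgroups of G are the H with [acts A, on H | to]. *)
Definition d_maximal (aT gT : finGroupType) (A : {group aT}) (G : {group gT})
    (to : groupAction A G) : Prop :=
  forall H : {group gT}, H \proper G -> [acts A, on H | to] -> 'm(H) < 'm(G).

(* Main.v *)
(* Replacing A by P = G ><| A, we may test d-maximality on normal subgroups of a
   p-group P containing G as a normal subgroup, and we show the stronger fact that
   Phi(G) is central in G. Otherwise, after factoring out a P-normal subgroup of
   index p in [Phi(G), G], this commutator has order p and is central. Let C be the
   centraliser of Phi(G) in G. As p is odd, Phi(C) is central in G. The commutator
   pairing of G with Phi(G) takes values in a group of order p, so
   |G : C| <= |Phi(G) : Phi(G) :&: Z(G)| <= |Phi(G) : Phi(C)|, that is,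
   |G : Phi(G)| <= |C : Phi(C)|. Hence d(G) <= d(C) for a proper P-normal
   subgroup C, contradicting d-maximality. *)

Require Import Defs.
From mathcomp Require Import all_boot all_fingroup all_solvable.

Local Open Scope group_scope.

(** Burnside's basis theorem: [G / 'Phi(G)] is elementary abelian, so its order is [p] to its own
    minimal number of generators, and lifts of its generators generate [G] because ['Phi(G)]
    consists of non-generators. *)
Lemma card_Phi_index (p : nat) (gT : finGroupType) (G : {group gT}) :
  p.-group G -> #|G : 'Phi(G)| = (p ^ 'm(G))%N.
Proof.
move=> pG; have nPhi := normal_norm (Phi_normal G).
have abQ := Phi_quotient_abelem pG.
rewrite -card_quotient // (card_pgroup (quotient_pgroup _ pG)).
rewrite -(rank_abelem abQ) -(grank_abelian (abelem_abelian abQ)).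
congr (_ ^ _)%N; apply/eqP; rewrite eqn_leq quotient_grank //=.
have [B genB <-] := grank_witness (G / 'Phi(G))%G.
have sBQ : B \subset G / 'Phi(G) by rewrite -genB subset_gen.
pose X := [set repr u | u : coset_of 'Phi(G) in B].
have sXG : X \subset G.
  apply/subsetP=> _ /imsetP[u uB ->].
  have /morphimP[y nPhiy yG ->] := subsetP sBQ u uB.
  rewrite val_coset //; apply: (subsetP (_ : 'Phi(G) :* y \subset G)).
    by rewrite mul_subG ?Phi_sub ?sub1set.
  by apply: mem_repr; apply: rcoset_refl.
have imX : coset 'Phi(G) @* X = B.
  apply/setP=> u; apply/morphimP/idP => [[_ _ /imsetP[v vB ->] ->]|uB].
    by rewrite /= coset_reprK.
  have Xu : repr u \in X by apply/imsetP; exists u.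
  by exists (repr u); rewrite //= ?coset_reprK // (subsetP nPhi) // (subsetP sXG).
have sXN : X \subset 'N('Phi(G)) := subset_trans sXG nPhi.
have genX : <<X>> = G.
  apply: Phi_nongen; rewrite -joing_idr norm_joinEr ?gen_subG //.
  have sgX : 'Phi(G) * <<X>> \subset G by rewrite mul_subG ?Phi_sub ?gen_subG.
  apply/eqP; rewrite eqEsubset sgX /= -quotientSK //.
  by rewrite quotient_gen // /quotient imX genB.
by rewrite -[in leqLHS]genX (leq_trans (grank_min X)) ?leq_imset_card.
Qed.

(* Adjoining one element x to U shrinks its centraliser by a factor of at most p,
   since the class of x lies in the coset x[U, G]. *)
Lemma index_cent_pairing (p : nat) (gT : finGroupType) (G U : {group gT}) :
  p.-group U -> #|[~: U, G]| <= p -> #|G : 'C_G(U)| <= #|U : 'C_U(G)|.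
Proof.
have [n] := ubnP #|U|; elim: n U => // n IHn U; rewrite ltnS => leUn pU leUGp.
have [cUG | ncUG] := boolP (U \subset 'C(G)).
  by rewrite (setIidPl (_ : G \subset 'C(U))) ?indexgg ?indexg_gt0 // centsC.
have prC : 'C_U(G) \proper U by rewrite properE subsetIl subsetI subxx.
(* Taking [V] maximal in [U] above ['C_U(G)] gives ['C_V(G) = 'C_U(G)], so passing from [V] to [U]
   multiplies the right-hand index by exactly [p]. *)
have [V maxV sCV] := @maxgroup_exists _ (fun M => M \proper U) _ prC.
have sVU : V \subset U := proper_sub (maxgroupp maxV).
have pVU : #|U : V| = p by apply: (p_maximal_index pU maxV).
have [x Ux nVx] : exists2 x, x \in U & x \notin V.
  by case/properP: (maxgroupp maxV).
have CVE : 'C_V(G) = 'C_U(G).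
  by apply/eqP; rewrite eqEsubset setSI //= subsetI sCV subsetIr.
have IHV : #|G : 'C_G(V)| <= #|V : 'C_U(G)|.
  rewrite -CVE; apply: IHn (pgroupS sVU pU) _.
    exact: leq_trans (proper_card (maxgroupp maxV)) leUn.
  by rewrite (leq_trans _ leUGp) // subset_leq_card ?commSg.
have genU : V <*> <[x]> = U.
  apply/eqP; rewrite eqEproper join_subG sVU cycle_subG Ux /=.
  apply: contra nVx => prVx; rewrite -cycle_subG.
  have /maxgroupP[_ /(_ _ prVx) eqV] := maxV.
  by have := joing_subr V <[x]>; rewrite /= eqV ?joing_subl.
have CUE : 'C_G(U) = 'C_G(V) :&: 'C[x] by rewrite -genU centY cent_cycle setIA.
have class_x : #|'C_G(V) : 'C_G(V) :&: 'C[x]| <= p.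
  rewrite index_cent1 (leq_trans _ leUGp) //.
  rewrite -(card_lcoset [~: U, G] x) subset_leq_card //.
  apply/subsetP=> _ /imsetP[y /setIP[Gy _] ->].
  by rewrite mem_lcoset -commgEl mem_commg.
rewrite CUE -(Lagrange_index (subsetIl _ _) (subsetIl _ _)) mulnC.
by rewrite -(Lagrange_index sVU sCV) pVU leq_mul.
Qed.

(* With C the centraliser of 'Phi(G) in G, the three subgroups lemma makes C' central,
   while 1 = [g^p, c] = [g, c]^p = [g, c^p] for c in C does the same for C^p. *)
Lemma Phi_cent_Phi_central (p : nat) (gT : finGroupType) (G : {group gT}) :
    odd p -> p.-group G ->
    [~: 'Phi(G), G] \subset 'Z(G) -> exponent [~: 'Phi(G), G] %| p ->
  'Phi('C_G('Phi(G))) \subset 'Z(G).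
Proof.
move=> p_odd pG sWZ expW; set C := 'C_G('Phi(G)).
have sCG : C \subset G := subsetIl _ _.
have cCPhi : C \subset 'C('Phi(G)) := subsetIr _ _.
have sG1Phi : G^`(1) \subset 'Phi(G) by rewrite (Phi_joing pG) joing_subl.
rewrite subsetI (subset_trans (Phi_sub _)) //=.
rewrite (Phi_joing (pgroupS sCG pG)) join_subG; apply/andP; split.
  have CG_C : [~: C, G, C] = 1.
    apply/commG1P; rewrite centsC (subset_trans cCPhi) // centS //.
    by rewrite (subset_trans _ sG1Phi) // commSg.
  apply/commG1P; apply: three_subgroup => //.
  by rewrite [[~: G, _]]commGC.
rewrite (MhoE 1 (pgroupS sCG pG)) gen_subG; apply/subsetP=> _ /imsetP[c Cc ->].
have Gc := subsetP sCG c Cc; rewrite expn1.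
apply/centP=> g Gg; apply/commgP.
set z := [~ g, c]; have Pz : z \in 'Phi(G) by rewrite (subsetP sG1Phi) ?mem_commg.
have cz : commute c z := centsP cCPhi c Cc z Pz.
have Ww : [~ z, g] \in [~: 'Phi(G), G] by rewrite mem_commg.
have /centerP[_ cw] := subsetP sWZ _ Ww.
(* Expand [(g ^+ p) ^ c = (g * z) ^+ p] as [g ^+ p * z ^+ p * [~ z, g] ^+ 'C(p, 2)]. As [p] is odd
   it divides ['C(p, 2)], so the last factor is 1, while [c] fixes [g ^+ p], which lies in
   ['Phi(G)]. *)
have zp : z ^+ p = 1.
  have := conjXg g c p; rewrite [g ^ c]conjg_mulR -/z expMg_Rmul //.
  - rewrite bin2odd // expgM (exponentP expW _ Ww) expg1n mulg1.
    have Pgp : g ^+ p \in 'Phi(G).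
      rewrite (Phi_joing pG) (subsetP (joing_subr _ _)) //.
      by rewrite -[p in g ^+ p]expn1 (Mho_p_elt 1 Gg) ?(mem_p_elt pG).
    rewrite conjgE -(centsP cCPhi c Cc _ Pgp) mulKg => /(congr1 (mulg (g ^+ p)^-1)).
    by rewrite mulVg mulKg.
  - by apply/commute_sym/cw; rewrite ?(subsetP (Phi_sub G)).
  - by apply/commute_sym/cw.
have zV : [~ c, g] = z^-1 by rewrite invg_comm.
by rewrite commXg zV ?expgVn ?zp ?invg1 //; apply: commuteV.
Qed.

Lemma index_Phi_cent_Phi (p : nat) (gT : finGroupType) (G : {group gT}) :
    odd p -> p.-group G ->
    [~: 'Phi(G), G] \subset 'Z(G) -> #|[~: 'Phi(G), G]| = p ->
  #|G : 'Phi(G)| <= #|'C_G('Phi(G)) : 'Phi('C_G('Phi(G)))|.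
Proof.
move=> p_odd pG sWZ oW; set C := 'C_G('Phi(G)).
have sPZ : 'Phi(C) \subset 'Z(G).
  by apply: (Phi_cent_Phi_central p) => //; rewrite -oW exponent_dvdn.
have sPP : 'Phi(C) \subset 'Phi(G) by apply: PhiS pG (subsetIl _ _).
have iC : #|G : C| <= #|'Phi(G) : 'Phi(C)|.
  have leWp : #|[~: 'Phi(G), G]| <= p by rewrite oW.
  apply: leq_trans (index_cent_pairing _ _ _ _ (pgroupS (Phi_sub G) pG) leWp) _.
  by apply/dvdn_leq/indexgS => //; rewrite subsetI sPP (subset_trans sPZ) ?subsetIr.
(* After multiplying by [#|'Phi(G)|], the two sides become [#|C| * #|G : C|] and
   [#|C| * #|'Phi(G) : 'Phi(C)|]. *)
rewrite -(leq_pmul2r (cardG_gt0 'Phi(G))).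
rewrite mulnC Lagrange ?Phi_sub // -(Lagrange (subsetIl G 'C('Phi(G)))) -/C.
rewrite -(Lagrange (Phi_sub 'C_G('Phi(G)))) -/C -(Lagrange sPP).
by rewrite mulnA [X in _ <= X * _]mulnC leq_mul2l iC orbT.
Qed.

Lemma normal_d_maximal_Phi (p : nat) (gT : finGroupType) (P G : {group gT}) :
    prime p -> odd p -> p.-group P -> G <| P ->
    (forall H : {group gT}, H \proper G -> H <| P -> 'm(H) < 'm(G)) ->
  'Phi(G) \subset 'Z(G).
Proof.
move=> p_pr p_odd pP nGP dmax; have sGP := normal_sub nGP.
have pG := pgroupS sGP pP.
rewrite subsetI Phi_sub (sameP commG1P eqP) /=; apply: contraT => ntW.
have nPhiP : 'Phi(G) <| P := gFnormal_trans _ nGP.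
have nWP : [~: 'Phi(G), G] <| P.
  by rewrite /normal comm_subG ?normsR ?normal_norm ?normal_sub.
have pW := pgroupS (normal_sub nWP) pP.
have W_gt0 : 0 < logn p #|[~: 'Phi(G), G]|.
  rewrite lt0n; apply: contra ntW => /eqP l0.
  by rewrite trivg_card1 (card_pgroup pW) l0.
(* [M] has index [p] in [[~: 'Phi(G), G]]; by [W_gt0] the predecessor of the logarithm is a genuine
   decrement. *)
have [M [sMW nMP oM]] := normal_pgroup pP nWP (leq_pred _).
have sMPhi : M \subset 'Phi(G) by rewrite (subset_trans sMW) ?commg_subl ?gFnorm.
have sMG : M \subset G by rewrite (subset_trans sMPhi) ?Phi_sub.
have nMG : G \subset 'N(M) by rewrite (subset_trans sGP) ?normal_norm.
have nMPhi : 'Phi(G) \subset 'N(M) by rewrite (subset_trans (Phi_sub G)).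
pose Q := (G / M)%G.
have pQ : p.-group Q by apply: quotient_pgroup.
have PhiQ : 'Phi(Q) = 'Phi(G) / M by rewrite -(quotient_Phi pG).
have WQ : [~: 'Phi(Q), Q] = [~: 'Phi(G), G] / M by rewrite PhiQ -quotientR.
have oWQ : #|[~: 'Phi(Q), Q]| = p.
  rewrite WQ card_quotient ?(subset_trans (normal_sub nWP)) ?normal_norm //.
  rewrite -divgS // oM [in X in X %/ _](card_pgroup pW).
  rewrite -expnB ?prime_gt0 ?leq_pred //.
  by rewrite -[n in n - _](prednK W_gt0) subSnn.
(* A nontrivial normal subgroup of a nilpotent group meets the centre; having prime order, it lies
   inside it. *)
have cWQ : [~: 'Phi(Q), Q] \subset 'Z(Q).
  have nWQQ : [~: 'Phi(Q), Q] <| Q.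
    by rewrite /normal commg_normr comm_subG ?Phi_sub.
  apply: prime_meetG; rewrite ?oWQ //.
  apply: (meet_center_nil (pgroup_nil pQ) nWQQ).
  by rewrite trivg_card1 oWQ; case: (p) p_pr => [|[]].
have le_index := index_Phi_cent_Phi p _ Q p_odd pQ cWQ oWQ.
have nCP : 'C_Q('Phi(Q)) <| P / M.
  have nQP : Q <| P / M by rewrite quotient_normal.
  rewrite /normal (subset_trans (subsetIl _ _) (normal_sub nQP)) /=.
  by rewrite normsI ?norms_cent ?normal_norm ?gFnormal_trans.
have [H defH sMH nHP] := inv_quotientN nMP nCP.
have sHG : H \subset G.
  have nMH := subset_trans (normal_sub nHP) (normal_norm nMP).
  by rewrite -(quotientSGK nMH sMG) -defH subsetIl.
(* If [H = G], then [Q] centralises ['Phi(Q)], so the commutator of order [p] is trivial and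
   [p = 1]. *)
have ltHG : H \proper G.
  rewrite properEneq sHG andbT; apply: contraTneq p_pr => eqHG.
  rewrite -oWQ (commG1P _) ?cards1 // centsC.
  by apply/setIidPl; rewrite defH eqHG.
(* The contradiction is ['m(G) <= 'm(H / M) <= 'm(H)], the first inequality being read off from the
   Frattini indices. *)
have := dmax H ltHG nHP; rewrite ltnNge => /negP[].
rewrite (leq_trans _ (quotient_grank (subset_trans sHG nMG))) //.
have pHM : p.-group (H / M) by rewrite quotient_pgroup ?(pgroupS sHG).
rewrite -(leq_exp2l _ _ (prime_gt1 p_pr)) -(card_Phi_index _ _ _ pG).
rewrite -(card_Phi_index _ _ _ pHM) /= -defH (leq_trans _ le_index) //.
by rewrite PhiQ index_quotient_eq ?Phi_sub // (setIidPr sMG).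
Qed.

Theorem theorem1p3 (p : nat) (aT gT : finGroupType)
    (A : {group aT}) (G : {group gT}) (to : groupAction A G)
    (p_prime : prime p) (p_odd : odd p) (pG : p.-group G) (pA : p.-group A)
    (dmaxG : d_maximal to) :
  nil_class G <= 2.
Proof.
pose s1 := sdpair1_morphism to.
have inj1 : 'injm s1 := injm_sdpair1 to.
have sPhiZ : 'Phi(s1 @* G) \subset 'Z(s1 @* G).
  have [nsG _ defP _ _] := sdprod_context (sdprod_sdpair to).
  apply: (normal_d_maximal_Phi p _ _ _ p_prime p_odd _ nsG).
    by rewrite -defP pgroupM !morphim_pgroup.
  move=> H prH nHP; rewrite (injm_grank inj1) //.
  have sHG := proper_sub prH.
  have defH : s1 @* (s1 @*^-1 H) = H by rewrite morphpreK // (subset_trans sHG) ?morphimS.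
  rewrite -[H in 'm(H)]defH (injm_grank inj1) ?subsetIl //.
  apply: dmaxG.
    by rewrite -(injm_proper inj1) ?subsetIl //= defH.
  (* Inside the semidirect product, invariance under [A] is normalisation by the image of [A]. *)
  rewrite actsEsd ?subsetIl //= defH.
  by rewrite (subset_trans _ (normal_norm nHP)) ?subsetT.
rewrite -(nil_class_injm inj1) // nil_class2 (subset_trans _ sPhiZ) //.
by rewrite (Phi_joing (morphim_pgroup _ pG)) joing_subl.
Qed.
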